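(* Let $d\ge1$, let $p,q,\alpha\in[1,\infty]$ be arbitrary and let $\rho>0$. Suppose there is a constant $C_\rho>0$ such that $$\Big\|\sum_j\lambda_j|\mathcal E_Na_j|^2\Big\|_{L^p_tL^q_x(\mathbb T^{d+1})}\le C_\rho N^\rho\|\lambda\|_{\ell^\alpha}$$ for every $N>1$, every $\lambda=(\lambda_j)_j\in\ell^\alpha$ and every orthonormal system $(a_j)_j$ in $\ell^2(\mathbb Z^d)$. Then $\alpha\le\alpha(\rho)$, where $\frac1{\alpha(\rho)}=1-\frac\rho d$; that is, $\frac1\alpha\ge1-\frac\rho d$.
   Context: $\mathbb T^d=(\mathbb R/\mathbb Z)^d$; in $\mathbb T^{d+1}$ the variables are $(x,t)$ with $x\in\mathbb T^d$, $t\in\mathbb T$, and $\|F\|_{L^p_tL^q_x}=\big\|\,\|F(\cdot,t)\|_{L^q_x}\big\|_{L^p_t}$. Let $S_{d,N}=\mathbb Z^d\cap[-N,N]^d$ and $\mathcal E_Na(x,t)=\sum_{n\in S_{d,N}}a_ne^{2\pi i(x\cdot n+t|n|^2)}$ for $a=(a_n)_{n\in\mathbb Z^d}\in\ell^2(\mathbb Z^d)$. With $a_j=\hat f_j$ the hypothesis is the same as the corresponding estimate for $\sum_j\lambda_j|e^{it\Delta}P_{\le N}f_j|^2$ with $(f_j)_j$ orthonormal in $L^2(\mathbb T^d)$, where $P_{\le N}$ is the Fourier cut-off to $[-N,N]^d$. *)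

(* Defs.v *)
From HB Require Import structures.
From mathcomp Require Import all_boot all_order all_algebra.
From mathcomp Require Import complex.
From mathcomp Require Import all_classical all_reals all_analysis.
From mathcomp Require Import zify.
From mathcomp Require showcase.summability.

Set Implicit Arguments.
Unset Strict Implicit.
Unset Printing Implicit Defensive.

Import Order.TTheory GRing.Theory Num.Theory numFieldNormedType.Exports.

Local Open Scope classical_set_scope.
Local Open Scope ring_scope.

(* The ascription is what gives R[i] its norm topology: the analysis library
   equips every numFieldType with one, but has no instance keyed on [complex]. *)
Notation cplx R := (complex R : numClosedFieldType) (only parsing).

Section torus.
Context {R : realType}.

(* The torus R/Z is represented by its fundamental domain [0, 1[; only functions
   with period 1 in each real variable are considered on it. *)
Definition circle_measure : set (measurableTypeR R) -> \bar R :=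
  mrestr lebesgue_measure (measurable_itv `[0%R, 1%R[).

HB.instance Definition _ := Measure.copy circle_measure
  (mrestr lebesgue_measure (measurable_itv `[0%R, 1%R[)).

Lemma circle_measure_setT : circle_measure [set: R] = 1%E.
Proof.
rewrite /circle_measure /mrestr setTI lebesgue_measure_itv/= lte_fin ltr01.
by rewrite sube0.
Qed.

HB.instance Definition _ :=
  Measure_isProbability.Build _ _ _ circle_measure circle_measure_setT.

Definition tuple_cons (d : nat)
    (y : measurableTypeR R * d.-tuple (measurableTypeR R)) :
  d.+1.-tuple (measurableTypeR R) :=
  [tuple of y.1 :: y.2].

Lemma measurable_tuple_cons d : measurable_fun setT (@tuple_cons d).
Proof. exact: measurable_cons. Qed.

HB.instance Definition _ d :=
  isMeasurableFun.Build _ _ _ _ (@tuple_cons d) (@measurable_tuple_cons d).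

Definition torus_cons d (P : probability (d.-tuple (measurableTypeR R)) R) :
  probability (d.+1.-tuple (measurableTypeR R)) R :=
  distribution (circle_measure \x P)%E (@tuple_cons d).

Fixpoint torus_measure (d : nat) : probability (d.-tuple (measurableTypeR R)) R :=
  if d is d'.+1 then torus_cons (torus_measure d')
  else dirac [tuple].

Definition mixed_norm (d : nat) (p q : \bar R) (F : d.-tuple R -> R -> cplx R) :
  \bar R :=
  Lnorm circle_measure p (fun t : R =>
    Lnorm (torus_measure d) q (fun x => (Normc.normc (F x t))%:E)).

End torus.

Section sequences.
Context {R : realType}.

Definition lnorm (alpha : \bar R) (lambda : nat -> cplx R) : \bar R :=
  Lnorm counting alpha (fun j => (Normc.normc (lambda j))%:E).

Definition in_l (alpha : \bar R) (lambda : nat -> cplx R) : Prop :=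
  (lnorm alpha lambda < +oo)%E.

Definition in_l2Z (d : nat) (a : d.-tuple int -> cplx R) : Prop :=
  (\esum_(n in [set: d.-tuple int]) (Normc.normc (a n) ^+ 2)%:E < +oo)%E.

(* [summability.sum] is the unconditional sum, that is the limit along the
   directed set of finite subsets of Z^d. *)
Definition innerZ (d : nat) (a b : d.-tuple int -> cplx R) : cplx R :=
  summability.sum (fun n => a n * (b n)^* : (cplx R)^o).

Definition orthonormal_system (d : nat) (a : nat -> d.-tuple int -> cplx R) : Prop :=
  (forall j, in_l2Z (a j)) /\
  (forall j k, innerZ (a j) (a k) = (j == k)%:R).

End sequences.

Section extension.
Context {R : realType}.

Definition freq_cube (d : nat) (N : R) : set (d.-tuple int) :=
  [set n | forall i : 'I_d, `|(tnth n i)%:~R| <= N].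

(* Without this, the finite-support sum in [extension_op] could default to 0. *)
Lemma finite_freq_cube (d : nat) (N : R) :
  finite_set (freq_cube N : set (d.-tuple int)).
Proof.
pose M := Num.bound `|N|.
pose g (f : {ffun 'I_d -> 'I_M.*2.+1}) : d.-tuple int :=
  [tuple ((f i : nat)%:Z - M%:Z) | i < d].
apply: (@sub_finite_set _ _ (range g)); last exact: finite_image.
move=> n nN; have bnd i : (`|tnth n i| <= M)%N.
  have h : `|(tnth n i)%:~R : R| < M%:R.
    apply: le_lt_trans (nN i) _; apply: le_lt_trans (ler_norm _) _.
    exact: archi_boundP.
  by move: h; rewrite -intr_norm -[M%:R]/(M%:Z%:~R) ltr_int; lia.
exists [ffun i => inord (absz (tnth n i + M%:Z))] => //.
apply: eq_from_tnth => i; rewrite tnth_mktuple ffunE inordK.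
  by have := bnd i; lia.
by have := bnd i; lia.
Qed.

Definition expi (theta : R) : cplx R := Complex (cos theta) (sin theta).

Definition phase (d : nat) (n : d.-tuple int) (x : d.-tuple R) (t : R) : R :=
  \sum_(i < d) tnth x i * (tnth n i)%:~R +
  t * \sum_(i < d) (tnth n i)%:~R ^+ 2.

Definition extension_op (d : nat) (N : R) (a : d.-tuple int -> cplx R)
    (x : d.-tuple R) (t : R) : cplx R :=
  \sum_(n \in freq_cube N) a n * expi (2 * pi * phase n x t).

(* By Bessel's inequality the series converges absolutely for bounded lambda
   and orthonormal a. *)
Definition density (d : nat) (N : R) (lambda : nat -> cplx R)
    (a : nat -> d.-tuple int -> cplx R) (x : d.-tuple R) (t : R) : cplx R :=
  limn (series (fun j => lambda j * `|extension_op N (a j) x t| ^+ 2)).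

End extension.

(* Main.v *)
(* Test the estimate on coordinate vectors: let lambda be the indicator of the
   first m^d indices and let a_j be the unit vector at n_j in Z^d, the first m^d
   frequencies n_j being those of [0, m[^d. Each |E_N a_j| is identically 1, so
   the density is the constant m^d, whose mixed norm on the torus is m^d for all
   p and q. Hence m^d <= C m^rho (m^d)^(1/alpha) for all m >= 2, and m -> oo
   gives d (1 - 1/alpha) <= rho. *)
Require Import Defs.
From HB Require Import structures.
From mathcomp Require Import all_boot all_order all_algebra.
From mathcomp Require Import complex.
From mathcomp Require Import all_classical all_reals all_analysis.
From mathcomp Require Import finmap ess_sup_inf zify lra.
From mathcomp Require showcase.summability.
Import Order.TTheory GRing.Theory Num.Theory numFieldNormedType.Exports.
Local Open Scope classical_set_scope.
Local Open Scope ring_scope.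

(** Total mass 1 makes the constant come out unscaled for finite [p]; for [p = +oo] positive mass
    suffices. *)
Lemma Lnorm_probability_cst (disp : measure_display) (T : measurableType disp)
    (R : realType) (P : probability T R) (p : \bar R) (c : R) :
  (1 <= p)%E -> 0 <= c -> Lnorm P p (cst c%:E) = c%:E.
Proof.
move=> p1 c0; rewrite unlock; case: p p1 => [r|_|] //=.
- rewrite lee_fin => r1; have r0 : r != 0 by rewrite gt_eqF// (lt_le_trans ltr01).
  rewrite integral_cst// [X in (_ * X)%E]probability_setT mule1.
  by rewrite poweR_EFin -powRrM mulfV// powRr1 ger0_norm.
- rewrite [X in (0 < X)%E]probability_setT lte01.
  rewrite (_ : _ \o _ = cst c%:E); last first.
    by apply/funext => x /=; rewrite ger0_norm.
  by rewrite ess_sup_cst// [X in (0 < X)%E]probability_setT lte01.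
Qed.

(** Every partial sum over a finite set containing [i0] equals [x i0], so the net is eventually
    constant. *)
Lemma summability_sum_single (I : choiceType) (K : numFieldType)
    (V : normedModType K) (x : I -> V) (i0 : I) :
  (forall i, i != i0 -> x i = 0) -> summability.sum x = x i0.
Proof.
move=> x0; apply: (@lim_near_cst _ (@norm_hausdorff _ _) _ _
  (summability.totally_filter)).
exists [fset i0]%fset => //= J /=; rewrite fsub1set => i0J.
rewrite /summability.partial_sum (bigD1 [` i0J]%fset)//= big1 ?addr0// => i ii0.
by apply: x0; apply: contra ii0 => /eqP i_i0; apply/eqP/val_inj.
Qed.

Lemma normc_nat (R : realType) (n : nat) : Normc.normc (n%:R : cplx R) = n%:R.
Proof.
by rewrite -(rmorph_nat (real_complex R)) /= /Normc.normc/= expr0n addr0 sqrtr_sqr ger0_norm.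
Qed.

Definition delta_system {R : realType} {d : nat} (e : nat -> d.-tuple int)
  (j : nat) (n : d.-tuple int) : cplx R := (n == e j)%:R.

Lemma orthonormal_delta_system (R : realType) (d : nat) (e : nat -> d.-tuple int) :
  injective e -> orthonormal_system (@delta_system R d e).
Proof.
move=> e_inj; split=> [j|j k].
  rewrite /in_l2Z (_ : (fun _ => _) = fun n => if n \in [set e j] then 1 else 0)%E.
    by rewrite -esum_mkcond esum_set1// ltry.
  apply/funext => n; rewrite /delta_system normc_nat.
  by case: eqVneq => [->|/eqP nj]; [rewrite mem_set ?expr1n | rewrite memNset ?expr0n].
rewrite /innerZ (summability_sum_single _ _ _ _ (e j)) => [|n nj].
  by rewrite /delta_system eqxx mul1r conjC_nat (inj_eq e_inj).
by rewrite /delta_system (negPf nj) mul0r.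
Qed.

Lemma normr_expi (R : realType) (theta : R) : `|expi theta| = 1 :> cplx R.
Proof. by rewrite /expi normc_def/= cos2Dsin2 sqrtr1. Qed.

Lemma extension_op_delta_system (R : realType) (d : nat) (N : R)
    (e : nat -> d.-tuple int) (j : nat) (x : d.-tuple R) (t : R) :
  freq_cube N (e j) ->
  extension_op N (delta_system e j) x t = expi (2 * pi * phase (e j) x t).
Proof.
move=> eN; rewrite /extension_op (fsbigD1 (e j))//=; last exact: finite_freq_cube.
rewrite fsbig1 => [|n [_ /eqP nj]].
  by rewrite addr0 /delta_system eqxx mul1r.
by rewrite /delta_system (negPf nj) mul0r.
Qed.

(** Each of the first [M] terms has modulus 1 and the coefficients vanish afterwards, so the partial
    sums are constant from rank [M] on. The later [e j] may lie outside the cube. *)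
Lemma density_delta_system (R : realType) (d : nat) (N : R) (M : nat)
    (e : nat -> d.-tuple int) (x : d.-tuple R) (t : R) :
  (forall j, (j < M)%N -> freq_cube N (e j)) ->
  density N (fun j => (j < M)%:R) (delta_system e) x t = M%:R.
Proof.
move=> eN; apply: lim_near_cst; first exact: norm_hausdorff.
near=> k; have Mk : (M <= k)%N by near: k; exact: nbhs_infty_ge.
rewrite /series/= (big_cat_nat _ Mk)//= [X in _ + X]big_nat_cond.
rewrite [X in _ + X]big1 ?addr0 => [|j /andP[/andP[Mj _] _]]; last first.
  by rewrite ltnNge Mj mul0r.
rewrite big_nat (eq_bigr (fun=> 1)) => [|j /= jM].
  by rewrite -big_nat big_const_nat subn0 iter_addr_0.
rewrite jM mul1r (extension_op_delta_system _ _ _ _ _ _ _ (eN _ jM)).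
exact: etrans (congr1 (fun z => z ^+ 2) (normr_expi _ _)) (expr1n _ _).
Unshelve. all: by end_near. Qed.

(** An orthonormal system is indexed by all of [nat], so the [m ^ d] points of [0, m[^d must be
    continued to an infinite injective family, which is possible since [d] is positive. *)
Lemma enumeration_freq_cube (R : realType) (d m : nat) : (0 < d)%N ->
  exists2 e : nat -> d.-tuple int, injective e &
    forall j, (j < m ^ d)%N -> freq_cube (m%:R : R) (e j).
Proof.
move=> d0; pose i0 := Ordinal d0.
pose s := [seq map_tuple (fun i : 'I_m => Posz i) u | u : d.-tuple 'I_m].
have sz : size s = (m ^ d)%N by rewrite size_map -cardE card_tuple card_ord.
have us : uniq s.
  rewrite map_inj_uniq ?enum_uniq// => u v /(congr1 val)/= uv.
  by apply/val_inj/(inj_map _ uv) => a b [] /val_inj.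
have sP n : n \in s -> forall i, 0 <= tnth n i < m%:Z.
  by move=> /mapP[u _ ->] i; rewrite tnth_map; apply/andP; split => //=; rewrite ltz_nat.
(* Points outside [0, m[^d, used to continue the enumeration injectively. *)
pose c j : d.-tuple int := nseq_tuple d (m + j)%:Z.
have cE j i : tnth (c j) i = (m + j)%:Z by rewrite /c (tnth_nth 0)/= nth_nseq ltn_ord.
have cs j : c j \notin s by apply/negP => /sP /(_ i0); rewrite cE; lia.
(* The default value depends on [j]: past the end of [s], [e j] is the diagonal point [c j]. *)
pose e j := nth (c j) s j.
have e_in j : (j < m ^ d)%N -> e j \in s by rewrite -sz => ?; exact: mem_nth.
have e_out j : (m ^ d <= j)%N -> e j = c j by rewrite -sz; exact: nth_default.
exists e => [j k jk|j /e_in/sP ejm i].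
  have [jm|jm] := ltnP j (m ^ d)%N; have [km|km] := ltnP k (m ^ d)%N.
  - move: jk; rewrite /e (set_nth_default (c k) (c j)) ?sz// => /eqP.
    by rewrite nth_uniq ?sz// => /eqP.
  - by have := e_in _ jm; rewrite jk e_out// (negPf (cs _)).
  - by have := e_in _ km; rewrite -jk e_out// (negPf (cs _)).
  - move: jk; rewrite !e_out// => /(congr1 (fun n => tnth n i0)).
    by rewrite !cE; lia.
rewrite -intr_norm -[m%:R]/(m%:Z%:~R) ler_int.
by have /andP[e0 /ltW em] := ejm i; rewrite ger0_norm.
Qed.

(** Equality can fail only for [alpha = +oo] and [M = 0], where the right-hand side is 0^0 = 1. *)
Lemma lnorm_indicator (R : realType) (alpha : \bar R) (M : nat) :
  (1 <= alpha)%E ->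
  (lnorm alpha (fun j => (j < M)%:R : cplx R)
     <= (M%:R `^ fine alpha^-1)%:E)%E.
Proof.
move=> alpha1; rewrite /lnorm; under eq_Lnorm do rewrite normc_nat.
case: alpha alpha1 => [r|_|] //.
- rewrite lee_fin => r1; have r0 : 0 < r by rewrite (lt_le_trans ltr01).
  rewrite Lnorm_counting// inver gt_eqF//=.
  rewrite (nneseries_split 0 M) => [|k _]; last by rewrite lee_fin powR_ge0.
  rewrite add0n eseries0 => [|k Mk _]; last first.
    by rewrite ltnNge Mk/= normr0 powR0// gt_eqF.
  rewrite adde0 big_nat (eq_bigr (fun=> 1%E)) => [|k /= kM].
    by rewrite -big_nat sumEFin big_const_nat subn0 iter_addr_0 poweR_EFin.
  by rewrite kM normr1 powR1.
- rewrite invey/= powRr0 unlock; case: ifPn => [_|]; last by rewrite lee_fin.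
  by apply/ess_supP/nearW => k /=; rewrite lee_fin ger0_norm// lern1 leq_b1.
Qed.

Lemma powR_bounded_le0 (R : realType) (s C : R) :
  (forall m : nat, (1 < m)%N -> m%:R `^ s <= C) -> s <= 0.
Proof.
move=> bnd; rewrite leNgt; apply/negP => s0.
have C0 : 0 <= C by apply: le_trans (bnd 2 isT); exact: powR_ge0.
(* Chosen so that [m] exceeds both 1 and C^(1/s), whence m^s > C. *)
pose m := (Num.bound (C `^ s^-1)).+2.
have Cm : C `^ s^-1 < m%:R.
  apply: (lt_trans (archi_boundP (powR_ge0 _ _))).
  by rewrite ltr_nat /m; lia.
have := bnd m isT; rewrite leNgt => /negP; apply.
have -> : C = (C `^ s^-1) `^ s by rewrite -powRrM mulVf ?lt0r_neq0// powRr1.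
by apply: gt0_ltr_powR; rewrite // nnegrE ?powR_ge0 ?ler0n.
Qed.

Theorem lemma3p1 (R : realType) (d : nat) (p q alpha : \bar R) (rho : R)
  (d_ge1 : (1 <= d)%N)
  (p_ge1 : (1 <= p)%E) (q_ge1 : (1 <= q)%E) (alpha_ge1 : (1 <= alpha)%E)
  (rho_gt0 : 0 < rho)
  (strichartz : exists2 C : R, 0 < C &
    forall (N : R) (lambda : nat -> cplx R) (a : nat -> d.-tuple int -> cplx R),
      1 < N -> in_l alpha lambda -> orthonormal_system a ->
      (mixed_norm p q (density N lambda a)
         <= (C * N `^ rho)%:E * lnorm alpha lambda)%E) :
  ((1 - rho / d%:R)%:E <= alpha^-1)%E.
Proof.
case: strichartz => C C0 strichartz.
(* The real number 1/alpha, equal to 0 when [alpha = +oo]. *)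
pose theta := fine alpha^-1.
have -> : alpha^-1%E = theta%:E.
  rewrite /theta fineK//; case: alpha alpha_ge1 {theta strichartz} => [r|_|] //.
  by rewrite lee_fin => r1; rewrite inver gt_eqF// (lt_le_trans ltr01).
(* The hypothesis at [N = m], tested on the unit vectors at the enumerated frequencies. *)
have main (m : nat) : (1 < m)%N ->
    (m ^ d)%:R <= C * m%:R `^ rho * (m ^ d)%:R `^ theta :> R.
  move=> m1; have [e e_inj e_cube] := enumeration_freq_cube R d m d_ge1.
  pose lambda j : cplx R := (j < m ^ d)%:R.
  have lambda_le := lnorm_indicator R alpha (m ^ d) alpha_ge1.
  have := strichartz m%:R lambda (delta_system e).
  rewrite ltr1n => /(_ m1 (le_lt_trans lambda_le (ltry _))).
  move=> /(_ (orthonormal_delta_system _ _ _ e_inj)).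
  (* The density is the constant m^d, so the inner norm is m^d for every [t], and then so is the
     outer one. *)
  rewrite /mixed_norm; under [X in (X <= _)%E]eq_Lnorm => t.
    under eq_Lnorm do rewrite density_delta_system// normc_nat.
    rewrite Lnorm_probability_cst//.
    over.
  rewrite Lnorm_probability_cst// => /le_trans H.
  rewrite -lee_fin EFinM; apply: H; apply: lee_wpmul2l lambda_le.
  by rewrite lee_fin mulr_ge0 ?powR_ge0// ltW.
have d0 : 0 < d%:R :> R by rewrite ltr0n.
(* Dividing [main] by m^(rho + d theta) leaves this exponent on [m], with the bound [C] uniform in
   [m]. *)
have : d%:R * (1 - theta) - rho <= 0.
  apply: (powR_bounded_le0 _ _ C) => m m1.
  have m0 : 0 < m%:R :> R by rewrite ltr0n ltnW.
  (* Covers the side conditions of both [powRD] and [powRB], which exclude a zero base in degenerate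
     cases. *)
  have nz b : b ==> (m%:R != 0 :> R) by rewrite (gt_eqF m0) implybT.
  have := main m m1; rewrite natrX -powR_mulrn ?ler0n// -powRrM -mulrA -powRD//.
  rewrite -ler_pdivrMr ?powR_gt0// -powRB//.
  by congr (_ `^ _ <= _); lra.
rewrite lee_fin subr_le0 => h.
by rewrite lerBlDl -lerBlDr ler_pdivlMr// mulrC.
Qed.
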